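(* Let $\mathbb{C}[\zeta,z]$ be the polynomial ring in two variables $\zeta,z$ over $\mathbb{C}$. Then $(\partial_z-\zeta)\,\mathbb{C}[\zeta,z]$ is a Mathieu subspace of $\mathbb{C}[\zeta,z]$; that is, the Image Conjecture $IC(1)$ is true.
   Context: ''For almost all $m$'' means for all positive integers $m$ with only finitely many exceptions. Let $k$ be a field and $R$ a commutative $k$-algebra. A $k$-linear subspace $M$ of $R$ is called a Mathieu subspace of $R$ if the following holds: whenever $f\in R$ satisfies $f^m\in M$ for all $m\ge 1$, then for every $g\in R$ one has $gf^m\in M$ for almost all $m$. Here $k=\mathbb{C}$, and $\partial_z-\zeta$ denotes the operator $h\mapsto \partial h/\partial z-\zeta h$ on $\mathbb{C}[\zeta,z]$. $IC(n)$ is the assertion that $\sum_{i=1}^n(\partial_{z_i}-\zeta_i)\mathbb{C}[\zeta_1,\ldots,\zeta_n,z_1,\ldots,z_n]$ is a Mathieu subspace of $\mathbb{C}[\zeta_1,\ldots,\zeta_n,z_1,\ldots,z_n]$. *)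

(* Defs.v *)
From mathcomp Require Import all_boot all_order all_algebra.
From mathcomp Require Import reals.
From mathcomp.real_closed Require Import complex.
From mathcomp Require Import mpoly.

Set Implicit Arguments.
Unset Strict Implicit.
Unset Printing Implicit Defensive.

Import GRing.Theory.
Local Open Scope ring_scope.

Definition almost_all (P : nat -> Prop) : Prop :=
  exists s : seq nat, forall m : nat, (0 < m)%N -> m \notin s -> P m.

(* Subsets are Prop-valued, since GRing.submod_closed needs a boolean predicate
   and the images below come without a decision procedure. *)
Definition linear_subspace (k : fieldType) (V : lmodType k)
    (M : V -> Prop) : Prop :=
  M 0 /\ forall (a : k) (u v : V), M u -> M v -> M (a *: u + v).

Definition mathieu_subspace (k : fieldType) (A : comAlgType k)
    (M : A -> Prop) : Prop :=
  linear_subspace M /\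
  forall f : A, (forall m : nat, (0 < m)%N -> M (f ^+ m)) ->
    forall g : A, almost_all (fun m => M (g * f ^+ m)).

(* With i the index of zeta and j the index of z, this is
   (d/dz - zeta) h. *)
Definition deriv_sub_var (R : realType) (n : nat) (i j : 'I_n)
    (h : {mpoly R[i][n]}) : {mpoly R[i][n]} :=
  h^`M(j) - 'X_i * h.

(* In the n + n variables, zeta_i is lshift n i and z_i is rshift n i. *)
Definition IC_image (R : realType) (n : nat)
    (f : {mpoly R[i][n + n]}) : Prop :=
  exists h : 'I_n -> {mpoly R[i][n + n]},
    f = \sum_(i < n) deriv_sub_var (lshift n i) (rshift n i) (h i).

Definition IC (R : realType) (n : nat) : Prop :=
  mathieu_subspace (@IC_image R n).

(* Main.v *)
Require Import Defs.
From HB Require Import structures.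
From mathcomp Require Import all_boot all_order all_algebra.
From mathcomp Require Import reals.
From mathcomp.real_closed Require Import complex.
From mathcomp Require Import mpoly.
From mathcomp Require Import ssrcomplements ring zify.

Set Implicit Arguments.
Unset Strict Implicit.
Unset Printing Implicit Defensive.

Import Order.TTheory GRing.Theory Num.Theory.
Local Open Scope ring_scope.

(** Write zeta, z for the two variables and M for the image of d/dz - zeta.
Modulo M, multiplication by zeta agrees with d/dz, so zeta^a z^b is congruent
to the a-th derivative of z^b. Hence M is homogeneous for the grading in which
z has weight 1 and zeta has weight -1, it contains every monomial of negative
weight, and on weight c >= 0 it is killed by the functional zeta^a z^(a+c)
|-> (a+c)! ([diag_laplace], [diag_laplace_image]).

The point is that if all positive powers of f lie in M, then f has only
monomials of negative weight ([weight_lt0_of_powers]). Once this is known, in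
g * f^m the weights are at most wt(g) - m, hence negative for m large, and
g * f^m lies in M ([image1_weight_lt0]).

To prove it, suppose that the largest weight d occurring in f is nonnegative,
and let f_d be the part of f of weight d. The part of f^m of weight d m is
f_d^m. Putting zeta = 1 turns f_d into a nonzero polynomial p(t), and
[diag_laplace] on weight d m into the functional L : t^k |-> k!, that is
L(p) = int_0^oo p(t) e^(-t) dt. So L(p^m) = 0 for all m >= 1, and this forces
p = 0 ([laplace1_exp_neq0], the one-variable factorial conjecture).

The latter is clear for constants, as L(p) = p; otherwise it is an asymptotic
computation. After scaling and squaring, p is monic
of degree d >= 2, and completing the d-th power gives p = (t + beta)^d + r
with deg r <= d - 2. With e_n the n-th partial sum of exp, L((t + beta)^N) is
N! e_N(beta). In the binomial expansion of p^m, each factor r costs two degrees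
and its combinatorial factor is beaten by the ratio of factorials, so that
L(p^m) / (dm)! = e_(dm)(beta) + O(1/m) ([laplace1_perturb]). Finally
e_N(beta) e_N(-beta) tends to 1 ([exp_sum_opp]), so e_N(beta) stays away from 0
and L(p^m) cannot vanish for m large. The constants come from bounds
on finite sums, and the archimedean property provides m. *)

(** * The functional t^k |-> k! *)

(** This is int_0^oo p(t) e^(-t) dt, the Laplace transform of p at 1. *)
Definition laplace1 (K : comNzRingType) (p : {poly K}) : K :=
  \sum_(i < size p) p`_i * i`!%:R.

Lemma laplace1_widen (K : comNzRingType) n (p : {poly K}) :
  (size p <= n)%N -> laplace1 p = \sum_(i < n) p`_i * i`!%:R.
Proof.
move=> le_pn; rewrite /laplace1 -!(big_mkord xpredT (fun i => p`_i * i`!%:R)).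
rewrite [RHS](big_cat_nat (n := size p)) //= [X in _ + X]big_nat_cond.
rewrite [X in _ + X]big1 ?addr0 // => i /andP[/andP[le_pi _] _].
by rewrite nth_default ?mul0r.
Qed.

Lemma laplace1_is_scalar (K : comNzRingType) : scalar (@laplace1 K).
Proof.
move=> a p q; pose n := maxn (size p) (size q).
have le_n : (size (a *: p + q)%R <= n)%N.
  rewrite (leq_trans (size_polyD _ _)) // geq_max leq_maxr andbT.
  by rewrite (leq_trans (size_scale_leq _ _)) ?leq_maxl.
rewrite (laplace1_widen le_n) (laplace1_widen (leq_maxl (size p) (size q))).
rewrite (laplace1_widen (leq_maxr (size p) (size q))).
rewrite mulr_sumr -big_split; apply: eq_bigr => i _.
by rewrite coefD coefZ mulrDl mulrA.
Qed.

HB.instance Definition _ (K : comNzRingType) :=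
  GRing.isLinear.Build K {poly K} K *%R (@laplace1 K) (@laplace1_is_scalar K).

Definition exp_sum (K : fieldType) (n : nat) (x : K) : K :=
  \sum_(i < n.+1) x ^+ i / i`!%:R.

Lemma natr_fact_neq0 (K : numFieldType) n : n`!%:R != 0 :> K.
Proof. by rewrite pnatr_eq0 -lt0n fact_gt0. Qed.

Lemma coef_XaddC_exp (K : comNzRingType) (b : K) n i :
  (('X + b%:P) ^+ n)`_i = b ^+ (n - i) *+ 'C(n, i).
Proof.
rewrite addrC exprDn coef_sum.
have eqF (j : 'I_n.+1) : (b%:P ^+ (n - j) * 'X ^+ j *+ 'C(n, j))`_i
   = if j == i :> nat then b ^+ (n - i) *+ 'C(n, i) else 0.
  rewrite coefMn -polyC_exp coefCM coefXn eq_sym.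
  by case: eqP => [->|_]; rewrite ?mulr1 // mulr0 mul0rn.
rewrite (eq_bigr _ (fun j _ => eqF j)) -big_mkcond.
have [lt_in|le_ni] := ltnP i n.+1.
  by rewrite (big_pred1 (Ordinal lt_in)).
rewrite big_pred0 ?bin_small ?mulr0n // => j.
by apply/negbTE; rewrite neq_ltn (leq_trans (ltn_ord j)).
Qed.

(** Expanding, C(n, i) * i! = n! / (n - i)!, which produces the terms of the
exponential series. *)
Lemma laplace1_XaddC (K : numFieldType) (b : K) n :
  laplace1 (('X + b%:P) ^+ n) = n`!%:R * exp_sum n b.
Proof.
have size_n : (size (('X + b%:P) ^+ n)%R <= n.+1)%N.
  by have:= size_exp_XsubC n (- b); rewrite polyCN opprK => ->.
rewrite (laplace1_widen size_n) mulr_sumr (reindex_inj rev_ord_inj) /=.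
apply: eq_bigr => i _; have le_in : (i <= n)%N by rewrite -ltnS.
rewrite coef_XaddC_exp subSS subKn // bin_sub // -(bin_fact le_in).
rewrite !natrM mulrA.
have := natr_fact_neq0 K i; move: (i`!%:R) => u u0.
by rewrite -mulr_natr; field.
Qed.

(** * Estimating the functional under a perturbation of lower degree *)

Definition dominated (K : numDomainType) (p P : {poly K}) : Prop :=
  forall i, `|p`_i| <= P`_i.

Section Domination.
Variable K : numFieldType.
Implicit Types p q P Q : {poly K}.

Lemma dominatedM p q P Q :
  dominated p P -> dominated q Q -> dominated (p * q) (P * Q).
Proof.
move=> pP qQ i; rewrite !coefM (le_trans (ler_norm_sum _ _ _)) // ler_sum // => j _.
by rewrite normrM ler_pM.
Qed.

Lemma dominatedX p P n : dominated p P -> dominated (p ^+ n) (P ^+ n).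
Proof.
move=> pP; elim: n => [|n IHn]; last by rewrite !exprS; apply: dominatedM.
by move=> i; rewrite !expr0 coef1 normr_nat.
Qed.

Lemma dominated_XaddC (b B : K) : `|b| <= B -> dominated ('X + b%:P) ('X + B%:P).
Proof.
move=> bB i; rewrite !coefD !coefX !coefC.
by case: i => [|[|i]]; rewrite ?add0r ?addr0 ?normr1 ?normr0.
Qed.

Lemma norm_laplace1 p P : dominated p P -> `|laplace1 p| <= laplace1 P.
Proof.
move=> pP; rewrite (laplace1_widen (leq_maxl (size p) (size P))).
rewrite (laplace1_widen (leq_maxr (size p) (size P))).
rewrite (le_trans (ler_norm_sum _ _ _)) // ler_sum // => i _.
by rewrite normrM normr_nat ler_wpM2r.
Qed.
End Domination.

Lemma leq_ffact2l a b k : (a <= b)%N -> (a ^_ k <= b ^_ k)%N.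
Proof.
elim: k a b => [|k IHk] [|a] [|b] //= leab.
by rewrite !ffactSS leq_mul ?IHk.
Qed.

(** Controls the k-th term of the expansion of ((t + beta)^d + r)^m, where
N = d m and k factors r lower the degree by 2 k. Here 'C(m, k) k! is the falling
factorial m^_k, and N!/(N - 2k)! splits into two falling factorials of length k,
each at least m^_k because N - k >= m; one of them absorbs m^_k, the other the
factor m. *)
Lemma perturbation_coef_bound (N m k : nat) :
  (2 * m <= N)%N -> (0 < k <= m)%N ->
  (m * 'C(m, k) * k`! * (N - 2 * k)`! <= N`!)%N.
Proof.
move=> le2mN /andP[k_gt0 le_km].
have le_kN : (k <= N)%N by lia.
have le_kN2 : (k <= N - k)%N by lia.
rewrite -(ffact_fact le_kN) -(ffact_fact le_kN2) -(mulnA m) bin_ffact mulnA.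
have -> : (N - k - k = N - 2 * k)%N by lia.
rewrite leq_mul2r; apply/orP; right; apply: leq_mul.
  have m_gt0 : (0 < m)%N by apply: leq_trans le_km.
  apply: leq_trans (leq_ffact2l k (_ : m <= N)%N); last by lia.
  case: k k_gt0 le_km {le_kN le_kN2} => // k _ le_km.
  by rewrite ffactnS leq_pmulr // ffact_gt0; lia.
by apply: leq_ffact2l; lia.
Qed.

Section Perturbation.
Variables (K : numFieldType) (beta B E c : K) (d : nat) (r : {poly K}).
Hypotheses (beta_le_B : `|beta| <= B) (B_ge1 : 1 <= B) (d_ge2 : (2 <= d)%N).
Hypothesis exp_sum_le : forall n, exp_sum n B <= E.
Hypotheses (size_r : (size r <= d.-1)%N) (r_le_c : forall i, `|r`_i| <= c).

(** As B >= 1, the coefficients of (t + B)^(d - 2) in degrees 0 to d - 2 are at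
least 1. Dominating r
by a power of the same linear polynomial that dominates t + beta makes all terms
of the expansion powers of t + B, where the functional is known. *)
Lemma dominated_remainder : dominated r (c *: ('X + B%:P) ^+ (d - 2)).
Proof.
have c_ge0 : 0 <= c by apply: le_trans (r_le_c 0).
have B_ge0 : 0 <= B by apply: le_trans B_ge1.
move=> i; rewrite coefZ coef_XaddC_exp.
have [lt_id|le_di] := ltnP i d.-1; last first.
  rewrite (nth_default _ (leq_trans size_r le_di)) normr0.
  by rewrite mulr_ge0 // mulrn_wge0 // exprn_ge0.
rewrite (le_trans (r_le_c i)) // ler_peMr //.
rewrite -mulr_natr (le_trans (_ : 1 <= B ^+ (d - 2 - i))) ?exprn_ege1 //.
by rewrite ler_peMr ?exprn_ge0 // ler1n bin_gt0; lia.
Qed.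

(** The term without r in the binomial expansion gives the main term; the k-th
term is at most c^k E (N - 2k)! 'C(m, k) <= N! E (c^k / k!) / m, and summing over
k gives a partial sum of exp at c. *)
Lemma laplace1_perturb m : (0 < m)%N ->
  `|laplace1 ((('X + beta%:P) ^+ d + r) ^+ m) - (d * m)`!%:R * exp_sum (d * m) beta|
    <= (d * m)`!%:R * (E * exp_sum m c / m%:R).
Proof.
move=> m_gt0; have c_ge0 : 0 <= c by apply: le_trans (r_le_c 0).
have B_ge0 : 0 <= B by apply: le_trans B_ge1.
have E_ge0 : 0 <= E.
  by apply: le_trans (exp_sum_le 0); rewrite /exp_sum big_ord1 divr1 expr0.
rewrite exprDn big_ord_recl subn0 expr0 mulr1 bin0 mulr1n -exprM raddfD /=.
rewrite laplace1_XaddC [X in `|X|]addrAC subrr add0r raddf_sum /=.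
rewrite (le_trans (ler_norm_sum _ _ _)) // /exp_sum big_ord_recl.
rewrite mulrDr [X in _ * X]mulrDl mulrDr -[X in X <= _]add0r.
apply: lerD; first by rewrite expr0 !mulr_ge0 ?invr_ge0 ?ler0n.
rewrite mulr_sumr mulr_suml mulr_sumr; apply: ler_sum => i _.
rewrite /bump leq0n add1n; set k := i.+1.
have k_bounds : (0 < k <= m)%N by rewrite /= ltn_ord.
have le2mN : (2 * m <= d * m)%N by rewrite leq_mul2r d_ge2 orbT.
set N := (d * m)%N in le2mN *.
have dom : dominated ((('X + beta%:P) ^+ d) ^+ (m - k) * r ^+ k)
    (c ^+ k *: ('X + B%:P) ^+ (N - 2 * k)).
  have -> : (N - 2 * k = d * (m - k) + (d - 2) * k)%N by rewrite /N; nia.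
  rewrite exprD [X in dominated _ X]scalerAr exprM.
  apply: dominatedM.
    by do 2!apply: dominatedX; apply: dominated_XaddC.
  by rewrite exprM -exprZn; apply: dominatedX; apply: dominated_remainder.
rewrite raddfMn /= normrMn.
have le_one : `|laplace1 ((('X + beta%:P) ^+ d) ^+ (m - k) * r ^+ k)|
    <= c ^+ k * ((N - 2 * k)`!%:R * E).
  rewrite (le_trans (norm_laplace1 dom)) // linearZ /= laplace1_XaddC.
  by rewrite ler_wpM2l ?exprn_ge0 // ler_wpM2l ?ler0n.
apply: (@le_trans _ _ (c ^+ k * E * ('C(m, k) * (N - 2 * k)`!)%:R)).
  rewrite [X in _ <= X](_ : _ = (c ^+ k * ((N - 2 * k)`!%:R * E)) *+ 'C(m, k)).
    by rewrite lerMn2r le_one orbT.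
  by rewrite -mulr_natr natrM; ring.
rewrite [X in _ <= X](_ : _ = c ^+ k * E * (N`!%:R / (m * k`!)%:R)); last first.
  by rewrite natrM invfM; ring.
rewrite ler_wpM2l ?mulr_ge0 ?exprn_ge0 // ler_pdivlMr ?ltr0n ?muln_gt0 ?m_gt0 ?fact_gt0 //.
rewrite -natrM ler_nat (leq_trans _ (perturbation_coef_bound le2mN k_bounds)) //.
by apply: eq_leq; ring.
Qed.
End Perturbation.

(** * Partial sums of the exponential series *)

(** From the index 2 b on, with b > B, each term is at most half of the previous
one; so the partial sum plus its last term no longer increases. *)
Lemma exp_sum_bounded (K : numFieldType) (B : K) : 0 <= B ->
  (exists n, `|B| < n%:R) -> exists E, forall n, exp_sum n B <= E.
Proof.
move=> B_ge0 [b]; rewrite ger0_norm // => lt_Bb.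
pose a i : K := B ^+ i / i`!%:R.
have a_ge0 i : 0 <= a i by rewrite mulr_ge0 ?exprn_ge0 ?invr_ge0 ?ler0n.
pose n0 := (2 * b)%N.
have halves n : (n0 <= n)%N -> a n.+1 *+ 2 <= a n.
  move=> le_n; rewrite -mulr_natr /a exprSr factS natrM invfM.
  rewrite [X in X <= _](_ : _ = (B ^+ n / n`!%:R) * ((B * 2) / n.+1%:R)); last by ring.
  apply: ler_piMr; first exact: a_ge0.
  rewrite ler_pdivrMr ?ltr0n // mul1r.
  apply: (@le_trans _ _ (b%:R * 2)); first by rewrite ler_wpM2r ?ler0n ?ltW.
  by rewrite -natrM ler_nat mulnC (leq_trans le_n).
have step n : exp_sum n.+1 B = exp_sum n B + a n.+1.
  by rewrite /exp_sum big_ord_recr.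
have mono n k : exp_sum n B <= exp_sum (n + k) B.
  elim: k => [|k IHk]; first by rewrite addn0.
  by rewrite addnS step (le_trans IHk) // lerDl.
exists (exp_sum n0 B + a n0) => n.
have tail k : exp_sum (n0 + k) B + a (n0 + k)%N <= exp_sum n0 B + a n0.
  elim: k => [|k IHk]; first by rewrite addn0.
  rewrite addnS step -addrA -mulr2n (le_trans _ IHk) // lerD2l.
  by rewrite halves // leq_addr.
have [le_n|/ltnW le_n] := leqP n0 n.
  by rewrite -(subnKC le_n); apply: le_trans (tail (n - n0)%N); rewrite lerDl.
have := mono n (n0 - n)%N; rewrite subnKC // => /le_trans; apply.
by rewrite lerDl.
Qed.

(** Partial sums as values at 1 of truncated series: products of partial sums
can then be compared coefficient by coefficient. *)
Definition exp_poly (K : fieldType) (n : nat) (x : K) : {poly K} :=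
  \poly_(i < n.+1) (x ^+ i / i`!%:R).

Lemma exp_poly1 (K : fieldType) n (x : K) : (exp_poly n x).[1] = exp_sum n x.
Proof.
rewrite horner_poly; apply: eq_bigr => i _.
by rewrite expr1n mulr1.
Qed.

Lemma coef_exp_polyM (K : numFieldType) n k (x y : K) : (k <= n)%N ->
  (exp_poly n x * exp_poly n y)`_k = (x + y) ^+ k / k`!%:R.
Proof.
move=> le_kn; rewrite addrC exprDn mulr_suml coefM; apply: eq_bigr => i _.
have le_ik : (i <= k)%N by rewrite -ltnS.
rewrite !coef_poly !ltnS (leq_trans le_ik) ?(leq_trans (leq_subr _ _)) //.
rewrite -(bin_fact le_ik) !natrM -(mulr_natr (_ * _)) (mulrC (y ^+ _)).
have := natr_fact_neq0 K i; have := natr_fact_neq0 K (k - i).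
have : 'C(k, i)%:R != 0 :> K by rewrite pnatr_eq0 -lt0n bin_gt0.
move: (i`!%:R) (_`!%:R) (_%:R) => u v w w0 v0 u0; field.
by rewrite u0 v0 w0.
Qed.

(** Up to degree n the product of the truncated series of exp(beta t) and
exp(- beta t) is 1. Its coefficients of degree k > n are bounded by 2^(-k) times
those of the square of the truncated series of exp(2 B t), which sum up to at
most E^2. *)
Lemma exp_sum_opp (K : numFieldType) n (beta B E : K) :
  `|beta| <= B -> exp_sum n (2 * B) <= E ->
  1 <= `|exp_sum n beta| * `|exp_sum n (- beta)| + E ^+ 2 / 2 ^+ n.
Proof.
move=> le_beta le_E; have B_ge0 : 0 <= B by apply: le_trans le_beta.
set P := exp_poly n beta * exp_poly n (- beta).
set Q := exp_poly n (2 * B) * exp_poly n (2 * B).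
have tail k : (n < k)%N -> `|P`_k| <= (2 ^+ n)^-1 * Q`_k.
  move=> lt_nk; rewrite !coefM (le_trans (ler_norm_sum _ _ _)) // mulr_sumr.
  rewrite ler_sum // => i _.
  have le_ik : (i <= k)%N by rewrite -ltnS.
  rewrite !coef_poly; case: ifP => _; last by rewrite !mul0r normr0 mulr0.
  case: ifP => _; last by rewrite !mulr0 normr0.
  rewrite !exprMn !normrM !normfV !normr_nat !normrX normrN.
  rewrite [X in _ <= X](_ : _ = (2 ^+ n)^-1 * 2 ^+ k *
      (B ^+ i / i`!%:R * (B ^+ (k - i) / (k - i)`!%:R))); last first.
    have -> : 2 ^+ k = 2 ^+ i * 2 ^+ (k - i) :> K by rewrite -exprD subnKC.
    by ring.
  apply: (@le_trans _ _ (B ^+ i / i`!%:R * (B ^+ (k - i) / (k - i)`!%:R))).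
    apply: ler_pM; rewrite ?mulr_ge0 ?invr_ge0 ?ler0n ?exprn_ge0 //;
    by rewrite ler_wpM2r ?invr_ge0 ?ler0n ?lerXn2r ?nnegrE.
  rewrite ler_peMl ?mulr_ge0 ?invr_ge0 ?ler0n ?exprn_ge0 //.
  by rewrite mulrC ler_pdivlMr ?exprn_gt0 // mul1r ler_weXn2l ?ler1n // ltnW.
(* A common length beyond n at which both polynomials can be summed. *)
pose N := (size P + size Q + n.+1)%N.
have PE : P.[1] = \sum_(0 <= k < N) P`_k.
  rewrite (@horner_coef_wide _ N) ?big_mkord ?/N -?addnA ?leq_addr //.
  by apply: eq_bigr => i _; rewrite expr1n mulr1.
have QE : Q.[1] = \sum_(0 <= k < N) Q`_k.
  rewrite (@horner_coef_wide _ N) ?big_mkord /N; last by lia.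
  by apply: eq_bigr => i _; rewrite expr1n mulr1.
have le_nN : (n.+1 <= N)%N by rewrite leq_addl.
have Q_ge0 k : 0 <= Q`_k.
  rewrite coefM sumr_ge0 // => i _; rewrite !coef_poly.
  by do 2!case: ifP => _;
    rewrite ?mulr0 ?mul0r ?mulr_ge0 ?invr_ge0 ?ler0n ?exprn_ge0 ?mulr_ge0.
have P1 : P.[1] = 1 + \sum_(n.+1 <= k < N) P`_k.
  rewrite PE (big_cat_nat (n := n.+1)) //=; congr (_ + _).
  rewrite big_nat_recl // big_nat big1 ?addr0 => [|k /andP[_ lt_kn]].
    by rewrite coef_exp_polyM // expr0 divr1.
  by rewrite coef_exp_polyM // subrr expr0n mul0r.
have tails : `|\sum_(n.+1 <= k < N) P`_k| <= (2 ^+ n)^-1 * Q.[1].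
  rewrite (le_trans (ler_norm_sum _ _ _)) // QE mulr_sumr.
  rewrite [X in _ <= X](big_cat_nat (n := n.+1)) //=.
  rewrite -[X in X <= _]add0r lerD ?sumr_ge0 // => [k _|].
    by rewrite mulr_ge0 ?invr_ge0 ?exprn_ge0.
  by apply: ler_sum_nat => k /andP[lt_nk _]; apply: tail.
have PM : P.[1] = exp_sum n beta * exp_sum n (- beta).
  by rewrite hornerM !exp_poly1.
have QM : Q.[1] <= E ^+ 2.
  rewrite hornerM !exp_poly1 expr2 ler_pM // /exp_sum sumr_ge0 // => k _;
  by rewrite mulr_ge0 ?invr_ge0 ?ler0n ?exprn_ge0 ?mulr_ge0.
have := ler_normB P.[1] (\sum_(n.+1 <= k < N) P`_k).
rewrite {1}P1 addrK normr1 PM normrM => /le_trans; apply; rewrite lerD2l.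
apply: (le_trans tails); rewrite mulrC; apply: ler_wpM2r QM.
by rewrite invr_ge0 exprn_ge0.
Qed.

(** * Nonvanishing on some power *)

Section FactorialConjecture.
Variable K : numFieldType.
Hypothesis archK : Num.archimedean_axiom K.

(** If the functional vanished at the m-th power, then e_N(beta) would be O(1/m),
whereas e_N(beta) e_N(-beta) is 1 up to O(2^-N) = O(1/m); m is taken beyond the
explicit constants. *)
Lemma laplace1_exp_neq0_shifted (beta : K) d (r : {poly K}) :
  (2 <= d)%N -> (size r <= d.-1)%N ->
  exists2 m, (0 < m)%N & laplace1 ((('X + beta%:P) ^+ d + r) ^+ m) != 0.
Proof.
move=> d_ge2 size_r; pose B : K := 1 + `|beta|.
have B_ge1 : 1 <= B by rewrite lerDl.
have B_ge0 : 0 <= B by apply: le_trans B_ge1.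
have beta_le_B : `|beta| <= B by rewrite lerDr.
pose c : K := \sum_(i < size r) `|r`_i|.
have c_ge0 : 0 <= c by rewrite sumr_ge0.
have r_le_c i : `|r`_i| <= c.
  have [lt_i|le_i] := ltnP i (size r); last by rewrite nth_default ?normr0.
  by rewrite /c (bigD1 (Ordinal lt_i)) //= lerDl sumr_ge0.
have [E exp_le_E] := exp_sum_bounded B_ge0 (archK B).
have [Ec exp_le_Ec] := exp_sum_bounded c_ge0 (archK c).
have B2_ge0 : 0 <= 2 * B by rewrite mulr_ge0.
have [E2 exp_le_E2] := exp_sum_bounded B2_ge0 (archK (2 * B)).
have E_ge0 : 0 <= E.
  by apply: le_trans (exp_le_E 0); rewrite /exp_sum big_ord1 divr1 expr0.
have Ec_ge0 : 0 <= Ec.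
  by apply: le_trans (exp_le_Ec 0); rewrite /exp_sum big_ord1 divr1 expr0.
(* The two error terms below add up to (E Ec E + E2^2) / m. *)
have [m lt_m] := archK (E * Ec * E + E2 ^+ 2).
have E2_ge0 : 0 <= E2.
  by apply: le_trans (exp_le_E2 0); rewrite /exp_sum big_ord1 divr1 expr0.
have bound_ge0 : 0 <= E * Ec * E + E2 ^+ 2 by rewrite addr_ge0 ?mulr_ge0 ?exprn_ge0.
have m_gt0 : (0 < m)%N by rewrite -(ltr0n K) (le_lt_trans _ lt_m).
rewrite ger0_norm // in lt_m.
exists m => //; apply/negP => /eqP L0.
have := laplace1_perturb beta_le_B B_ge1 d_ge2 exp_le_E size_r r_le_c m_gt0.
set N := (d * m)%N; rewrite L0 sub0r normrN normrM normr_nat.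
rewrite ler_pM2l ?ltr0n ?fact_gt0 // => small.
have := exp_sum_opp (n := N) beta_le_B (exp_le_E2 N).
have le_opp : `|exp_sum N (- beta)| <= E.
  rewrite (le_trans _ (exp_le_E N)) // (le_trans (ler_norm_sum _ _ _)) //.
  rewrite ler_sum // => i _.
  rewrite normrM normfV normr_nat normrX normrN.
  by rewrite ler_wpM2r ?invr_ge0 ?ler0n // lerXn2r ?nnegrE.
have le_prod : `|exp_sum N beta| * `|exp_sum N (- beta)| <= E * Ec * E / m%:R.
  apply: (@le_trans _ _ (E * exp_sum m c / m%:R * E)); first by rewrite ler_pM.
  by rewrite mulrAC ler_wpM2r ?invr_ge0 ?ler0n // ler_wpM2r // ler_wpM2l.
have le_pow : E2 ^+ 2 / 2 ^+ N <= E2 ^+ 2 / m%:R.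
  rewrite ler_wpM2l ?exprn_ge0 // lef_pV2 ?posrE ?exprn_gt0 ?ltr0n //.
  rewrite -natrX ler_nat (leq_trans _ (ltnW (ltn_expl N (ltnSn 1)))) //.
  by rewrite leq_pmull // ltnW.
move=> /le_trans /(_ (lerD le_prod le_pow)); rewrite -mulrDl ler_pdivlMr ?ltr0n // mul1r.
by move=> /le_lt_trans /(_ lt_m); rewrite ltxx.
Qed.

(** Squaring the normalized polynomial makes its degree d at least 2, so that
N = d m >= 2 m; the shift beta = q_(d-1) / d cancels the coefficient of degree
d - 1. *)
Lemma laplace1_exp_neq0 (p : {poly K}) : p != 0 ->
  exists2 m, (0 < m)%N & laplace1 (p ^+ m) != 0.
Proof.
move=> p_neq0; have a_neq0 : lead_coef p != 0 by rewrite lead_coef_eq0.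
have [/size1_polyC pC|size_p] := leqP (size p) 1.
  exists 1%N => //; rewrite expr1 pC (laplace1_widen (size_polyC_leq1 _)).
  rewrite big_ord1 coefC /= mulr1; apply: contraNneq p_neq0 => p0.
  by rewrite pC p0 polyC0.
pose q := ((lead_coef p)^-1 *: p) ^+ 2.
pose d := (size q).-1.
have q_monic : q \is monic.
  by rewrite monicE lead_coef_exp lead_coefZ mulVf ?expr1n.
have size_q : size q = d.+1 by rewrite prednK ?size_poly_gt0 ?monic_neq0.
have d_ge2 : (2 <= d)%N.
  rewrite /d size_exp size_scale ?invr_eq0 // muln2 -[2%N]/(1.*2)%N.
  by rewrite leq_double -ltnS prednK // ltnW.
pose beta := q`_d.-1 / d%:R.
have d_neq0 : d%:R != 0 :> K by rewrite pnatr_eq0; lia.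
have [|m m_gt0 Lm] := @laplace1_exp_neq0_shifted beta d (q - ('X + beta%:P) ^+ d) d_ge2.
  apply/leq_sizeP => j le_j; rewrite coefB coef_XaddC_exp.
  have [lt_dj|le_jd] := ltnP d j.
    by rewrite bin_small // mulr0n subr0 nth_default // size_q.
  have [->|->] : j = d \/ j = d.-1 by lia.
    by rewrite subnn binn expr0 -lead_coefE (monicP q_monic) subrr.
  have -> : (d - d.-1 = 1)%N by lia.
  have -> : 'C(d, d.-1) = d by rewrite -subn1 bin_sub ?bin1 // ltnW.
  by rewrite expr1 -mulr_natr divfK ?subrr.
exists (2 * m)%N; first by rewrite muln_gt0.
move: Lm; rewrite addrC subrK /q -exprM exprZn linearZ /=.
by rewrite mulf_eq0 negb_or => /andP[].
Qed.
End FactorialConjecture.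

(** * The grading by deg z - deg zeta *)

(** All weights deg_j - deg_i of f are at most b - a. Two natural numbers are used
since weights may be negative. *)
Definition weight_le n (K : nzRingType) (i j : 'I_n) (a b : nat)
    (f : {mpoly K[n]}) : Prop :=
  forall m, m \in msupp f -> (m j + a <= m i + b)%N.

Section Weight.
Variables (n : nat) (K : nzRingType) (i j : 'I_n).
Implicit Types f g : {mpoly K[n]}.
Local Notation weight_le := (@weight_le n K i j).

Lemma weight_leD a b f g : weight_le a b f -> weight_le a b g -> weight_le a b (f + g).
Proof.
by move=> wf wg m /msuppD_le; rewrite mem_cat => /orP[/wf|/wg].
Qed.

Lemma weight_leM a b a' b' f g :
  weight_le a b f -> weight_le a' b' g -> weight_le (a + a') (b + b') (f * g).
Proof.
move=> wf wg m /msuppM_le /allpairsP[[m1 m2] /= [/wf w1 /wg w2 ->]].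
by rewrite !mnmDE; lia.
Qed.

Lemma weight_leX a b f k : weight_le a b f -> weight_le (a * k) (b * k) (f ^+ k).
Proof.
move=> wf; elim: k => [|k IHk].
  by move=> m; rewrite expr0 msupp1 inE => /eqP ->; rewrite !mnm0E !muln0.
by rewrite exprS !mulnS; apply: weight_leM.
Qed.

Lemma weight_le_exists f : exists b, weight_le 0 b f.
Proof.
exists (\max_(m <- msupp f) m j)%N => m m_f.
by rewrite addn0 (leq_trans _ (leq_addl _ _)) //
   (@leq_bigmax_seq _ _ xpredT (fun m : 'X_{1..n} => m j)).
Qed.

(** Equality in the top weight is preserved by powers. *)
Lemma weight_le_subX b f g k :
  weight_le 0 b f -> weight_le 0 b g -> weight_le 1 b (f - g) ->
  weight_le 1 (b * k) (f ^+ k - g ^+ k).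
Proof.
move=> wf wg wfg; elim: k => [|k IHk].
  by move=> m; rewrite !expr0 subrr msupp0.
have -> : f ^+ k.+1 - g ^+ k.+1 = f * (f ^+ k - g ^+ k) + (f - g) * g ^+ k.
  by rewrite !exprS mulrBl mulrBr addrA subrK.
rewrite mulnS; apply: weight_leD.
  by rewrite -[1%N]/(0 + 1)%N; apply: weight_leM.
by rewrite -[1%N]/(1 + 0)%N -{2}[0%N](mul0n k); apply/weight_leM/weight_leX.
Qed.
End Weight.

(** * Powers in the image force negative weights *)

Section DiagonalLaplace.
Variable K : numFieldType.
Implicit Types (f g : {mpoly K[2]}) (c : nat).
Local Notation zeta := (ord0 : 'I_2).
Local Notation z := (ord_max : 'I_2).

Definition diag_coef c (m : 'X_{1..2}) : K :=
  if m z == (m zeta + c)%N then (m z)`!%:R else 0.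

Definition diag_laplace c f : K := \sum_(m <- msupp f) f@_m * diag_coef c m.

Lemma diag_laplace_widen c f k : (msize f <= k)%N ->
  diag_laplace c f = \sum_(m : 'X_{1..2 < k}) f@_m * diag_coef c m.
Proof.
move=> le_fk; rewrite /diag_laplace (big_mksub 'X_{1..2 < k}) ?msupp_uniq //=;
  first last.
  by move=> x /msize_mdeg_lt /leq_trans; apply.
by rewrite big_rmcond //= => m /memN_msupp_eq0 ->; rewrite mul0r.
Qed.

Lemma diag_laplace_is_scalar c : scalar (diag_laplace c).
Proof.
move=> a f g; pose k := maxn (maxn (msize f) (msize g)) (msize (a *: f + g)).
rewrite !(@diag_laplace_widen _ _ k) ?leq_max ?leqnn ?orbT //.
rewrite mulr_sumr -big_split; apply: eq_bigr => m _ /=.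
by rewrite mcoeffD mcoeffZ mulrDl mulrA.
Qed.

HB.instance Definition _ c :=
  GRing.isLinear.Build K {mpoly K[2]} K *%R (diag_laplace c) (diag_laplace_is_scalar c).

Lemma diag_laplaceX c (m : 'X_{1..2}) : diag_laplace c 'X_[m] = diag_coef c m.
Proof. by rewrite /diag_laplace msuppX big_seq1 mcoeffX eqxx mul1r. Qed.

(** On h = zeta^a z^b with b = a + c + 1, both terms take the value b!, since
b (b - 1)! = b!; elsewhere both vanish. *)
Lemma diag_laplace_image c h : diag_laplace c (h^`M(z) - 'X_zeta * h) = 0.
Proof.
rewrite {1 2}(mpolyE h) raddf_sum mulr_sumr -sumrB raddf_sum big1 //= => m _.
rewrite mderivZ mderivX -scalerAr -scalerBr linearZ -mpolyXD raddfB /= linearZ /=.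
rewrite !diag_laplaceX.
rewrite [X in _ * X](_ : _ = 0) ?mulr0 // /diag_coef.
rewrite !mnmDE !mnmBE !mnm1E /= !subn0 add1n.
case: (m z) => [|b]; first by rewrite mul0r sub0r oppr0.
by rewrite subn1 add0n /= eqSS; case: eqP => _; rewrite ?mulr0 ?subr0 // factS natrM subrr.
Qed.

Lemma diag_laplace_lt c f : weight_le zeta z 1 c f -> diag_laplace c f = 0.
Proof.
move=> wf; rewrite /diag_laplace big_seq big1 // => m /wf w_m.
by rewrite /diag_coef; case: eqP => [?|_]; [lia|rewrite mulr0].
Qed.

Definition dehomogenize : {mpoly K[2]} -> {poly K} :=
  mmap (@polyC K) (fun i => if i == z then 'X else 1).

Lemma dehomogenizeE f : dehomogenize f = \sum_(m <- msupp f) f@_m *: 'X^(m z).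
Proof.
rewrite /dehomogenize /mmap; apply: eq_bigr => m _.
rewrite mul_polyC /mmap1 big_ord_recl big_ord1 /=.
rewrite expr1n mul1r; congr (_ *: 'X^(m _)); exact: val_inj.
Qed.

Definition weight_homog c f : Prop := forall m, m \in msupp f -> m z = (m zeta + c)%N.

Lemma weight_homogM b c f g : weight_homog b f -> weight_homog c g -> weight_homog (b + c) (f * g).
Proof.
move=> hf hg m /msuppM_le /allpairsP[[m1 m2] /= [/hf w1 /hg w2 ->]].
by rewrite !mnmDE; lia.
Qed.

Lemma weight_homogX c f k : weight_homog c f -> weight_homog (c * k) (f ^+ k).
Proof.
move=> hf; elim: k => [|k IHk].
  by move=> m; rewrite expr0 msupp1 inE => /eqP ->; rewrite !mnm0E !muln0.
by rewrite exprS !mulnS; apply: weight_homogM.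
Qed.

Lemma diag_laplace_homog c f : weight_homog c f ->
  diag_laplace c f = laplace1 (dehomogenize f).
Proof.
move=> hf; rewrite dehomogenizeE raddf_sum /diag_laplace !big_seq.
apply: eq_bigr => m /hf hm; rewrite /= linearZ /= /diag_coef hm eqxx.
have := laplace1_XaddC (0 : K) (m zeta + c)%N; rewrite addr0 => ->.
rewrite /exp_sum big_ord_recl big1 /= ?expr0 ?divr1 ?addr0 ?mulr1 //.
by move=> i _; rewrite exprS mul0r mul0r.
Qed.

(** Within a fixed weight, a monomial is determined by its exponent of z, so no
cancellation can occur. *)
Lemma dehomogenize_neq0 c f : weight_homog c f -> f != 0 -> dehomogenize f != 0.
Proof.
move=> hf; rewrite -msupp_eq0; case E: (msupp f) => [|m0 s] // _.
have m0_f : m0 \in msupp f by rewrite E mem_head.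
apply/eqP => /(congr1 (fun p : {poly K} => p`_(m0 z))).
rewrite dehomogenizeE coef0 coef_sum (bigD1_seq m0) ?msupp_uniq //= big_seq_cond big1.
  by rewrite addr0 coefZ coefXn eqxx mulr1 => /eqP; rewrite mcoeff_eq0 m0_f.
move=> m /andP[m_f neq_m]; rewrite coefZ coefXn.
case: eqP => [eq_z|_]; last by rewrite mulr0.
case/eqP: neq_m; apply/mnmP => i; have := hf _ m_f; have := hf _ m0_f.
case: (unliftP zeta i) => [k|] -> /=; last by lia.
suff -> : lift zeta k = z by [].
by apply/val_inj; rewrite /= (ord1 k).
Qed.

Definition weight_part c f : {mpoly K[2]} :=
  \sum_(m <- msupp f | m z == (m zeta + c)%N) f@_m *: 'X_[m].

Lemma mcoeff_weight_part c f k :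
  (weight_part c f)@_k = if k z == (k zeta + c)%N then f@_k else 0.
Proof.
rewrite /weight_part raddf_sum /=.
rewrite (eq_bigr (fun m => if m == k then f@_k else 0)); last first.
  move=> m _; rewrite mcoeffZ mcoeffX.
  by case: eqP => [->|_]; rewrite ?mulr1 ?mulr0.
have [k_f|k_f] := boolP (k \in msupp f); last first.
  rewrite (memN_msupp_eq0 k_f) big1 => [|m _]; last by case: ifP.
  by case: ifP.
case: ifP => hk; last first.
  by rewrite big1_seq // => m /andP[hm _]; case: eqP => [Em|//]; rewrite Em hk in hm.
rewrite big_mkcond (bigD1_seq k) ?msupp_uniq //= hk eqxx big1 ?addr0 // => m.
by move=> /negbTE ->; rewrite if_same.
Qed.

Lemma weight_part_homog c f : weight_homog c (weight_part c f).
Proof.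
move=> m; rewrite mcoeff_msupp mcoeff_weight_part.
by case: (m z =P _) => // _; rewrite eqxx.
Qed.

Lemma weight_part_rem c f : weight_le zeta z 0 c f ->
  weight_le zeta z 1 c (f - weight_part c f).
Proof.
move=> wf m; rewrite mcoeff_msupp mcoeffB mcoeff_weight_part.
case: (eqVneq (m z)) => [_|neq]; first by rewrite subrr eqxx.
by rewrite subr0 -mcoeff_msupp => /wf; lia.
Qed.

(** Otherwise let d >= 0 be the largest weight of f. Weight d m in f^m only sees
the m-th power of the part of weight d, hence the functional t^k |-> k! kills all
powers of a nonzero polynomial. *)
Lemma weight_lt0_of_powers f : Num.archimedean_axiom K ->
  (forall c m, (0 < m)%N -> diag_laplace c (f ^+ m) = 0) ->
  weight_le zeta z 1 0 f.
Proof.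
move=> archK Lf; have [b wf] := weight_le_exists zeta z f.
(* The nonnegative weights of f are bounded; if there is one, take the largest. *)
pose P c := has (fun m : 'X_{1..2} => m z == (m zeta + c)%N) (msupp f).
have [/existsP[c Pc]|noP] := boolP [exists c : 'I_b.+1, P c]; last first.
  move=> m m_f; rewrite addn0 addn1 ltnNge; apply: contra noP => le_m.
  have le_b : (m z - m zeta <= b)%N by have := wf _ m_f; lia.
  apply/existsP; exists (Ordinal (le_b : m z - m zeta < b.+1)%N) => /=.
  by apply/hasP; exists m => //=; apply/eqP; lia.
have P_le d : P d -> (d <= b)%N by case/hasP=> m /wf w_m /eqP; lia.
have [d /hasP[m m_f /eqP m_d] max_d] := ex_maxnP (ex_intro P _ Pc) P_le.
have wfd : weight_le zeta z 0 d f.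
  move=> k k_f; have [|lt_k] := leqP (k z) (k zeta); first by lia.
  have : P (k z - k zeta)%N by apply/hasP; exists k => //=; apply/eqP; lia.
  by move/max_d; lia.
pose fd := weight_part d f.
have hfd : weight_homog d fd by apply: weight_part_homog.
have fd_neq0 : fd != 0.
  apply: contraTneq m_f => fd0; rewrite mcoeff_msupp negbK.
  by have := mcoeff_weight_part d f m; rewrite -/fd fd0 mcoeff0 m_d eqxx => <-.
have [k k_gt0] := laplace1_exp_neq0 archK (dehomogenize_neq0 hfd fd_neq0).
case/negP; rewrite -rmorphXn -(diag_laplace_homog (weight_homogX (k := k) hfd)).
rewrite -[fd ^+ k](subKr (f ^+ k)) raddfB /= Lf // sub0r oppr_eq0.
apply/eqP/diag_laplace_lt/weight_le_subX => //; last exact: weight_part_rem.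
by move=> j /hfd; lia.
Qed.
End DiagonalLaplace.

(** * The image of d/dz - zeta *)

Section Image.
Variable R : realType.
Local Notation zeta := (ord0 : 'I_2).
Local Notation z := (ord_max : 'I_2).

Lemma complex_archimedean : Num.archimedean_axiom R[i].
Proof.
move=> x; exists (Num.Def.archi_bound (Num.sqrt (complex.Re x ^+ 2 + complex.Im x ^+ 2))).
by rewrite normc_def -[X in _ < X](rmorph_nat (real_complex R)) ltcR archi_boundP ?sqrtr_ge0.
Qed.

Definition image1 (f : {mpoly R[i][2]}) : Prop :=
  exists h : {mpoly R[i][2]}, f = deriv_sub_var zeta z h.

Lemma image1_subspace : linear_subspace image1.
Proof.
split; first by exists 0; rewrite /deriv_sub_var mderiv0 mulr0 subrr.
move=> a _ _ [h ->] [k ->]; exists (a *: h + k).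
rewrite /deriv_sub_var mderivD mderivZ mulrDr -scalerAr scalerBr.
by rewrite opprD addrACA.
Qed.

(** Write m as zeta times k: modulo the image 'X_[m] is the z-derivative of
'X_[k], which has the same weight and a smaller exponent of z. Repeating this,
the exponent of z reaches 0 before that of zeta, and then the derivative is 0. *)
Lemma image1X (m : 'X_{1..2}) : (m z < m zeta)%N -> image1 'X_[m].
Proof.
have [im0 imD] := image1_subspace.
move Emz: (m z) => b; elim: b m Emz => [|b IHb] m mz lt_m.
all: pose k := (m - U_(zeta))%MM.
all: have Em : m = (U_(zeta) + k)%MM
  by rewrite addmC submK //; apply/mnm_lepP => i; rewrite mnm1E; case: eqP => // <-; lia.
all: have kz : k z = m z by rewrite mnmBE mnm1E subn0.
all: have EX : 'X_[m] = (m z)%:R *: 'X_[k - U_(z)]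
    + -1 *: deriv_sub_var zeta z 'X_[k] :> {mpoly R[i][2]}
  by rewrite /deriv_sub_var mderivX kz -mpolyXD -Em scaleN1r opprB addrC subrK.
all: have imk : image1 (-1 *: deriv_sub_var zeta z 'X_[k])
  by rewrite -[_ *: _]addr0; apply: imD => //; exists 'X_[k].
  by rewrite EX mz scale0r add0r.
rewrite EX; apply: imD imk; apply: IHb; rewrite !mnmBE !mnm1E /= ?mz; lia.
Qed.

Lemma image1_weight_lt0 f : weight_le zeta z 1 0 f -> image1 f.
Proof.
have [im0 imD] := image1_subspace; move=> wf; rewrite (mpolyE f) big_seq.
by apply: big_ind => [//|p q imp imq|m /wf w_m];
   [rewrite -[p]scale1r|rewrite -[_ *: _]addr0]; apply: imD => //; apply: image1X; lia.
Qed.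

(** If all weights of g are at most b, then those of g * f^m are at most b - m;
the finitely many exceptions are m <= b. *)
Lemma image1_mathieu : mathieu_subspace image1.
Proof.
split=> [|f imf g]; first exact: image1_subspace.
have wf : weight_le zeta z 1 0 f.
  apply: weight_lt0_of_powers complex_archimedean _ => c m m_gt0.
  by have [h ->] := imf m m_gt0; apply: diag_laplace_image.
have [b wg] := weight_le_exists zeta z g.
exists (iota 0 b.+1) => m m_gt0; rewrite mem_iota add0n ltnS -ltnNge => lt_bm.
apply: image1_weight_lt0 => k /(weight_leM wg (weight_leX (k := m) wf)).
lia.
Qed.

Lemma IC_image1 f : IC_image (n := 1) f <-> image1 f.
Proof.
have E1 : lshift 1 (ord0 : 'I_1) = zeta by apply: val_inj.
have E2 : rshift 1 (ord0 : 'I_1) = z by apply: val_inj.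
split=> [[h ->]|[h ->]].
  by rewrite big_ord1 E1 E2; exists (h ord0).
by exists (fun=> h); rewrite big_ord1 E1 E2.
Qed.
End Image.

Theorem theorem7p1 (R : realType) :
  let zeta : 'I_2 := ord0 in
  let z : 'I_2 := ord_max in
  mathieu_subspace
    (fun f : {mpoly R[i][2]} =>
       exists h : {mpoly R[i][2]}, f = deriv_sub_var zeta z h)
  /\ IC R 1.
Proof.
split; first exact: image1_mathieu.
have [[im0 imD] imM] := image1_mathieu R; split.
  split=> [|a u v /IC_image1 imu /IC_image1 imv]; first exact/IC_image1.
  exact/IC_image1/imD.
move=> f imf g; have [|s sP] := imM f _ g.
  by move=> m m_gt0; apply/IC_image1/imf.
by exists s => m m_gt0 m_s; apply/IC_image1/sP.
Qed.
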